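(* Let $*$ be the binary operation $x*y=g^{-1}(g(x)+g(y))$ with identity element $e$, where $g$ is continuous and strictly increasing on a real interval $A$. Let $F$ be the continuous distribution function of a random variable with interval of support $(a,b)$, where $a<e$, and let $(a,b]\subseteq A$. Then $F$ satisfies $$F(x)\cdot F(t)=F(x*t)\cdot F(e)\quad\text{for all } x,t \text{ with } a<x<b,\ e\le t\le b,\ x*t\le b,$$ if and only if there is a constant $c>0$ such that $$F(x)=\exp\big[c\,(g(x)-g(b))\big]\quad\text{for all } x\in(a,b).$$
   Context: The operation $*$ is a continuous, associative and reducible binary operation on a real interval $A$ (reducible: $x*y=x*z$ if and only if $y=z$, and $y*w=z*w$ if and only if $y=z$). It is represented as $x*y=g^{-1}(g(x)+g(y))$, for $x,y,x*y\in A$, with $g:A\to\mathbb{R}$ continuous and strictly increasing. It has an identity element $e\in A$, meaning $x*e=x$ for all $x\in A$ (so $g(e)=0$). For a random variable with distribution function $F$, the interval of support is $(a,b)$, where $a=\inf\{x:F(x)>0\}$ and $b=\sup\{x:F(x)<1\}$, $-\infty\le a<b\le\infty$. The functional equation in the claim is called the generalized reversed lack of memory property.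
   Formalization: The formal theorem adds the hypothesis e < b: if e = b the equation only allows t = e and is trivial, and if e > b it is vacuous, so every F satisfies it (e.g. g = ln, e = b = 1, a = 0, F(x) = 3x²−2x³ on (0,1)) and the claim fails. *)

(* Defs.v *)
From HB Require Import structures.
From mathcomp Require Import all_boot all_order all_algebra.
From mathcomp Require Import all_classical all_reals all_analysis.

Set Implicit Arguments.
Unset Strict Implicit.
Unset Printing Implicit Defensive.

Import Order.TTheory GRing.Theory Num.Theory.
Import numFieldNormedType.Exports.

Local Open Scope classical_set_scope.
Local Open Scope ring_scope.

Section generated_operation.
Context {R : realType}.
Implicit Types (A : set R) (g F : R -> R).

(* x * y = g^-1 (g x + g y), with g^-1 the inverse of g : A -> g @` A. *)
Definition gop A g (x y : R) : R := 'pinv_(fun=> 0) A g (g x + g y).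

(* "x * y lies in A": the operation may be partial on A, and [gop A g x y] is
   meaningful only when g x + g y is a value of g on A. *)
Definition gop_defined A g (x y : R) : Prop := (g @` A) (g x + g y).

Definition gop_identity A g (e : R) : Prop :=
  A e /\ forall x, A x -> gop_defined A g x e /\ gop A g x e = x.

Definition support_interval F (a b : \bar R) : Prop :=
  [/\ a = ereal_inf (EFin @` [set x | 0 < F x]),
      b = ereal_sup (EFin @` [set x | F x < 1]) & (a < b)%E].

Definition gen_reversed_lack_of_memory A g (e : R) (a : \bar R) (b : R) F :
    Prop :=
  forall x t : R, (a < x%:E)%E -> x < b -> e <= t <= b ->
    gop_defined A g x t -> gop A g x t <= b ->
    F x * F t = F (gop A g x t) * F e.

End generated_operation.

(* Main.v *)
Require Import Defs.
From HB Require Import structures.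
From mathcomp Require Import all_boot all_order all_algebra.
From mathcomp Require Import all_classical all_reals all_analysis.
From mathcomp Require Import lra.

(** In the coordinate [u = g x] the operation becomes addition, [e] becomes
    [0], and the functional equation says that
    [phi u = ln F (g^-1 u) - ln F e] satisfies Cauchy's equation
    [phi (u + s) = phi u + phi s] on the interval [g @` (a, b]], for steps
    [s] in [[0, g b]] only.  A distribution function is nondecreasing, so [phi] is
    nonnegative on [[0, g b]], and Cauchy's equation then forces
    [phi u = c * u] on the whole interval ([nonneg_additive_linear]); taking
    [x = b], where [F b = 1], gives [F e = expR (- c * g b)], whence the
    exponential form.  The constant [c] is positive because [e < b] makes
    [F e < 1].

    The linearity proof works on a bounded interval, where the usual
    approximation by rational multiples is awkward.  Subtracting the linear
    part leaves an additive function [psi] vanishing at [beta = g b] and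
    bounded on [[0, beta]]; doubling modulo [beta] stays in the interval and
    doubles [psi], so boundedness forces [psi = 0] there
    ([bounded_additive_eq0]).  Negative arguments are reached by translating
    by [beta] finitely often.

    Conversely, once [F b = 1] is known, the exponential form holds on
    [(a, b]] and the functional equation is [expR (u + v) = expR u * expR v].
*)

Set Implicit Arguments.
Unset Strict Implicit.
Unset Printing Implicit Defensive.

Import Order.TTheory GRing.Theory Num.Theory.
Import numFieldNormedType.Exports.

Local Open Scope classical_set_scope.
Local Open Scope ring_scope.

(** * Cauchy's equation on a bounded interval *)

(** If [psi u != 0], the orbit of [u] under doubling modulo [beta] carries
    values [2 ^ n * psi u], which are unbounded. *)
Lemma bounded_additive_eq0 (R : realType) (psi : R -> R) (beta M : R) :
  (forall u s, 0 <= u -> 0 <= s -> u + s <= beta ->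
    psi (u + s) = psi u + psi s) ->
  psi beta = 0 ->
  (forall u, 0 <= u <= beta -> `|psi u| <= M) ->
  forall u, 0 <= u <= beta -> psi u = 0.
Proof.
move=> psiD psib psiM.
have double u : 0 <= u <= beta ->
    exists2 v, 0 <= v <= beta & psi v = 2 * psi u.
  move=> /andP[u0 ub]; have [u2|u2] := leP (u + u) beta.
    by exists (u + u); [lra|rewrite psiD //; lra].
  exists (u + u - beta); first by lra.
  have := psiD (u + u - beta) (beta - u).
  have := psiD u (beta - u).
  have -> : u + (beta - u) = beta by lra.
  have -> : u + u - beta + (beta - u) = u by lra.
  move=> /(_ ltac:(lra) ltac:(lra) ltac:(lra)) h1.
  move=> /(_ ltac:(lra) ltac:(lra) ltac:(lra)) h2.
  lra.
(* The linear bound [n.+1 <= 2 * n] for [0 < n] is all that is needed of the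
   growth of [2 ^ n]. *)
have bnd n : forall u, 0 <= u <= beta -> n%:R * `|psi u| <= M.
  elim: n => [|n IHn] u hu.
    by rewrite mul0r (le_trans _ (psiM _ hu)).
  have [->|n0] := eqVneq n 0%N; first by rewrite mul1r; exact: psiM.
  have [v hv vE] := double u hu.
  have := IHn v hv.
  rewrite vE normrM ger0_norm // mulrA; apply: le_trans.
  rewrite ler_wpM2r // -natrM ler_nat.
  by rewrite muln2 -addnn -addn1 leq_add2l lt0n.
move=> u hu; apply/eqP/negPn/negP => psi0.
have pu : 0 < `|psi u| by rewrite normr_gt0.
have M0 : 0 <= M by rewrite (le_trans _ (psiM _ hu)).
have := archi_boundP (divr_ge0 M0 (ltW pu)).
by rewrite ltr_pdivrMr // ltNge bnd.
Qed.

(** Steps [s] stay in [[0, beta]], so [phi] at a negative point is compared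
    with its values in [[0, beta]] by repeated translation by [beta]. *)
Lemma nonneg_additive_linear (R : realType) (D : set R) (phi : R -> R)
    (beta : R) :
  0 < beta -> D 0 ->
  (forall u v, D u -> u <= v <= beta -> D v) ->
  (forall u s, D u -> 0 <= s <= beta -> u + s <= beta ->
    phi (u + s) = phi u + phi s) ->
  (forall u, 0 <= u <= beta -> 0 <= phi u) ->
  forall u, D u -> u <= beta -> phi u = phi beta / beta * u.
Proof.
move=> beta0 D0 Dup phiD phi0.
set c := phi beta / beta; pose psi u := phi u - c * u.
have cb : c * beta = phi beta by rewrite mulfVK // gt_eqF.
have psib : psi beta = 0 by rewrite /psi cb subrr.
have psiD u s : D u -> 0 <= s <= beta -> u + s <= beta ->
    psi (u + s) = psi u + psi s.
  by move=> Du s01 us; rewrite /psi phiD //; lra.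
have phib : 0 <= phi beta by apply: phi0; lra.
have c0 : 0 <= c by rewrite divr_ge0 // ltW.
have psiM u : 0 <= u <= beta -> `|psi u| <= phi beta.
  move=> hu; have h1 := phi0 u hu.
  have h2 : 0 <= phi (beta - u) by apply: phi0; lra.
  have h3 : phi beta = phi u + phi (beta - u).
    rewrite -phiD; [congr phi; lra| |lra|lra].
    by apply: (Dup 0).
  have h4 : 0 <= c * u by rewrite mulr_ge0 //; lra.
  have h5 : c * u <= phi beta by rewrite -cb ler_wpM2l //; lra.
  by rewrite ler_norml /psi; lra.
have psi0 u : 0 <= u <= beta -> psi u = 0.
  apply: (bounded_additive_eq0 _ psib psiM) => {}u s u0 s0 us.
  by apply: psiD; [apply: (Dup 0) => //; lra|lra|].
have shift n : forall u, D u -> u <= beta -> - (n%:R * beta) <= u -> psi u = 0.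
  elim: n => [|n IHn] u Du ub nu; first by apply: psi0; lra.
  have [u0|u0] := leP 0 u; first by apply: psi0; lra.
  have := psiD u beta Du ltac:(lra) ltac:(lra); rewrite psib addr0 => <-.
  apply: IHn; [by apply: (Dup u) => //; lra|lra|].
  by move: nu; rewrite mulrSr mulrDl; lra.
move=> u Du ub; apply/eqP; rewrite -subr_eq0; apply/eqP.
have := archi_boundP (divr_ge0 (normr_ge0 u) (ltW beta0)).
rewrite ltr_pdivrMr // => hn.
apply: (shift (Num.bound (`|u| / beta))) => //.
by rewrite lerNl (le_trans _ (ltW hn)) // -normrN ler_norm.
Qed.

(** * Distribution functions and their interval of support *)

Section support.
Context {R : realType}.
Implicit Types (F : R -> R) (a b : \bar R).

Lemma support_gt0 F a b x :
  {homo F : x y / x <= y} -> support_interval F a b ->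
  (a < x%:E)%E -> 0 < F x.
Proof.
move=> Fmono [-> _ _] /ereal_inf_lt[_ [y Fy <-]].
by rewrite lte_fin => /ltW/Fmono; apply: lt_le_trans.
Qed.

Lemma support_lt1 F a b x :
  {homo F : x y / x <= y} -> support_interval F a b ->
  (x%:E < b)%E -> F x < 1.
Proof.
move=> Fmono [_ -> _] /ereal_sup_gt[_ [y Fy <-]].
by rewrite lte_fin => /ltW/Fmono /le_lt_trans; apply.
Qed.

(** If [F b < 1], continuity would give [F < 1] slightly beyond [b]. *)
Lemma support_right_end F a (b : R) :
  continuous F -> (forall x, F x <= 1) -> support_interval F a b%:E ->
  F b = 1.
Proof.
move=> Fcont F1 [_ bE _]; apply/le_anti; rewrite F1 leNgt; apply/negP => Fb.
have : \forall x \near b, F x < 1 by exact: cvgr_lt (Fcont b) _ Fb.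
move=> /nbhs_ballP[r /= r0 rF].
have : F (b + r / 2) < 1.
  apply: rF; rewrite /ball /= opprD addrA subrr add0r normrN gtr0_norm; lra.
move=> Fr; have : ((b + r / 2)%:E <= b%:E)%E.
  by rewrite bE; apply: ereal_sup_ubound; exists (b + r / 2).
by rewrite lee_fin; lra.
Qed.

End support.

(** * The operation generated by [g] *)

Lemma gopE (R : realType) (A : set R) (g : R -> R) (x t y : R) :
  {in A &, injective g} -> A y -> g y = g x + g t -> gop A g x t = y.
Proof.
by move=> g_inj Ay gy; rewrite /gop -gy (pinvKV _ g_inj) ?inE.
Qed.

(** [e * e = e] reads [g e + g e = g e]. *)
Lemma gop_identity_eq0 (R : realType) (A : set R) (g : R -> R) (e : R) :
  gop_identity A g e -> g e = 0.
Proof.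
move=> [Ae /(_ e Ae)[[y Ay gy]]]; rewrite /gop => ee.
have := @pinvK _ _ (fun=> 0) A g (g e + g e).
rewrite inE ee => /(_ _)/wrap[|]; first by exists y.
lra.
Qed.

(** * The characterization *)

Theorem theorem2p1 (R : realType)
  (A : set R) (g : R -> R) (e : R)
  (A_itv : is_interval A)
  (g_cont : {within A, continuous g})
  (g_incr : {in A &, {homo g : x y / x < y}})
  (e_id : gop_identity A g e)
  (d : measure_display) (T : measurableType d) (P : probability T R)
  (X : {RV P >-> R}) (F : R -> R)
  (F_cdf : forall x, cdf X x = (F x)%:E)
  (F_cont : continuous F)
  (a : \bar R) (b : R)
  (F_supp : support_interval F a b%:E)
  (a_lt_e : (a < e%:E)%E)
  (e_lt_b : e < b)
  (abA : [set x : R | (a < x%:E)%E /\ x <= b] `<=` A) :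
  gen_reversed_lack_of_memory A g e a b F <->
  exists2 c : R, 0 < c &
    forall x : R, (a < x%:E)%E -> x < b -> F x = expR (c * (g x - g b)).
Proof.
have Fmono : {homo F : x y / x <= y}.
  by move=> x y xy; rewrite -lee_fin -!F_cdf; exact: cdf_nondecreasing.
have F1 x : F x <= 1 by rewrite -lee_fin -F_cdf; exact: cdf_le1.
have Fgt0 x : (a < x%:E)%E -> 0 < F x := support_gt0 Fmono F_supp.
have Fb : F b = 1 := support_right_end F_cont F1 F_supp.
have Fe1 : F e < 1 by apply: (support_lt1 Fmono F_supp); rewrite lte_fin.
have gle : {in A &, {mono g : x y / x <= y}} := le_mono_in g_incr.
have ginj : {in A &, injective g} := inc_inj_in gle.
have ge0 : g e = 0 := gop_identity_eq0 e_id.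
have a_lt x y : (a < x%:E)%E -> x <= y -> (a < y%:E)%E.
  by move=> ax xy; rewrite (lt_le_trans ax) // lee_fin.
have inA x : (a < x%:E)%E -> x <= b -> x \in A.
  by move=> ax xb; rewrite inE; apply: abA.
have ab := a_lt _ _ a_lt_e (ltW e_lt_b).
have eA : e \in A := inA _ a_lt_e (ltW e_lt_b).
have bA : b \in A := inA _ ab (lexx b).
have gb0 : 0 < g b by rewrite -ge0 g_incr.
(* Continuity of [g] makes [x * t] defined as soon as [g x + g t <= g b]. *)
have ivt x v : (a < x%:E)%E -> x <= b -> g x <= v <= g b ->
    exists2 y, x <= y <= b & g y = v.
  move=> ax xb /andP[xv vb].
  have [||y yI <-] := @IVT _ g x b v xb.
  - apply: continuous_subspaceW g_cont => z /=; rewrite in_itv /= => /andP[xz zb].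
    by apply: abA; split=> //; exact: a_lt xz.
  - by rewrite ge_min xv le_max vb orbT.
  by exists y => //; move: yI; rewrite in_itv.
split=> [lom|[c c0 FE]]; last first.
  have {}FE x : (a < x%:E)%E -> x <= b -> F x = expR (c * (g x - g b)).
    move=> ax; rewrite le_eqVlt => /predU1P[->|/FE]; last exact.
    by rewrite subrr mulr0 expR0.
  move=> x t ax xb /andP[et tb] [y Ay gy].
  rewrite (gopE ginj Ay gy) => yb.
  have at_ := a_lt _ _ a_lt_e et.
  have gt0 : 0 <= g t by rewrite -ge0 gle // inA.
  have xA : x \in A by rewrite inA // ltW.
  have yA : y \in A by rewrite inE.
  have xy : x <= y by rewrite -(gle x y xA yA) gy lerDl.
  rewrite !FE ?(ltW xb) ?(ltW e_lt_b) //; last exact: a_lt xy.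
  by rewrite -!expRD; congr expR; rewrite gy ge0; lra.
pose h := 'pinv_(fun=> 0) A g.
have hK x : (a < x%:E)%E -> x <= b -> h (g x) = x.
  by move=> ax xb; apply: pinvKV ginj _ _; exact: inA.
pose phi u := ln (F (h u)) - ln (F e).
have phiE x : (a < x%:E)%E -> x <= b -> phi (g x) = ln (F x) - ln (F e).
  by move=> ax xb; rewrite /phi hK.
pose D := [set g x | x in [set x : R | (a < x%:E)%E /\ x <= b]].
have D0 : D 0 by exists e => //; split=> //; exact: ltW.
have Dup u v : D u -> u <= v <= g b -> D v.
  move=> [x [ax xb] <-] /(ivt x v ax xb)[y /andP[xy yb] <-].
  by exists y => //; split=> //; exact: a_lt xy.
have phiD u s : D u -> 0 <= s <= g b -> u + s <= g b ->
    phi (u + s) = phi u + phi s.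
  move=> [x [ax xb] <-] /andP[s0 sb] us.
  have [y /andP[xy yb] gy] := ivt x (g x + s) ax xb ltac:(lra).
  have ay := a_lt _ _ ax xy.
  have [xlb|bx] := ltP x b; last first.
    (* At [x = b] the only admissible step is [s = 0]. *)
    have xE : x = b by apply/le_anti; rewrite xb.
    have -> : s = 0 by move: us; rewrite xE; lra.
    by rewrite addr0 -ge0 (phiE e) ?(ltW e_lt_b) // subrr addr0.
  have [t /andP[et tb] gt] : exists2 t, e <= t <= b & g t = s.
    by apply: ivt; rewrite ?ge0 ?s0 // ltW.
  have at_ := a_lt _ _ a_lt_e et.
  have gy' : g y = g x + g t by rewrite gt.
  have yA : A y by apply: abA.
  have xt : gop A g x t = y := gopE ginj yA gy'.
  have := lom x t ax xlb.
  rewrite et tb xt => /(_ isT)/(_ ltac:(by exists y))/(_ yb) FF.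
  have : ln (F x * F t) = ln (F y * F e) by rewrite FF.
  rewrite !lnM ?posrE ?Fgt0 //.
  by rewrite -gt -gy' !phiE //; lra.
have phi0 u : 0 <= u <= g b -> 0 <= phi u.
  move=> hu; have [|t /andP[et tb] <-] := ivt e u a_lt_e (ltW e_lt_b).
    by rewrite ge0.
  have at_ := a_lt _ _ a_lt_e et.
  by rewrite phiE // subr_ge0 ler_ln ?posrE ?Fgt0 // Fmono.
have phi_lin := nonneg_additive_linear gb0 D0 Dup phiD phi0.
have phib : phi (g b) = - ln (F e) by rewrite phiE // Fb ln1 sub0r.
set c := phi (g b) / g b in phi_lin.
have cb : c * g b = phi (g b) by rewrite mulfVK // gt_eqF.
exists c.
  by rewrite divr_gt0 // phib oppr_gt0 ln_lt0 // Fgt0.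
move=> x ax /ltW xb.
have Dx : D (g x) by exists x.
have := phi_lin _ Dx; rewrite gle ?inA // => /(_ xb).
rewrite phiE // => lnFx.
by rewrite -[F x]lnK ?posrE ?Fgt0 //; congr expR; lra.
Qed.
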